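(* Let $T_n^1$ and $T_n^2$ be two independent uniform attachment trees with $n$ vertices each, and let $Y_n$ be the size of their Ulam--Harris common subtree, i.e. the number of Ulam--Harris labels that appear in both $T_n^1$ and $T_n^2$. For every $\varepsilon > 0$, $$\lim_{n\to\infty}\mathbb{P}\left(Y_n \geq n^{2(\sqrt{2}-1)-\varepsilon}\right) = 1 .$$ In particular, $\lim_{n\to\infty}\mathbb{P}\left(Y_n \geq n^{0.828}\right) = 1$.
   Context: A uniform attachment tree is defined recursively: $T_1$ is a single vertex, and given $T_n$, the tree $T_{n+1}$ is obtained by adding one new vertex and joining it by a single edge to a vertex of $T_n$ chosen uniformly at random, independently of everything else. The Ulam--Harris labels of the vertices are elements of $\bigcup_{k\ge 0}\mathbb{N}^k$ (with $\mathbb{N}=\{1,2,\ldots\}$, $\mathbb{N}^0=\{\varnothing\}$), assigned as follows: the first vertex has label $\varnothing$; if a new vertex attaches to a vertex with label $(i_1,\ldots,i_k)$ to which exactly $j-1$ vertices have attached previously in the process, then the new vertex gets label $(i_1,\ldots,i_k,j)$. Labels within one tree are distinct. *)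

(* Defs.v *)
From mathcomp Require Import all_boot all_order all_algebra finmap.
From mathcomp Require Import all_classical all_reals all_analysis.
Set Implicit Arguments.
Unset Strict Implicit.
Unset Printing Implicit Defensive.
Import Order.TTheory GRing.Theory Num.Theory.
Import numFieldNormedType.Exports.
Local Open Scope classical_set_scope.
Local Open Scope ring_scope.

(* A tree grown by successive attachments is encoded by the sequence of the
   parents of its non-root vertices: vertices are numbered 0, 1, 2, ... in order
   of arrival, and entry m is the parent of vertex m.+1. A tree with n.+1
   vertices is thus a sequence of length n; the one-vertex tree is [::]. *)
Definition attach_tree := seq nat.

Definition attach (t : attach_tree) (v : nat) : attach_tree := rcons t v.

(* The tree with n vertices (n >= 1) in which c m is the vertex chosen when a new
   vertex is attached to the tree with m.+1 vertices. The value at n = 0 is junk. *)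
Fixpoint grow (c : nat -> nat) (n : nat) : attach_tree :=
  match n with
  | m'.+1 as m => if m' is p.+1 then attach (grow c m') (c p) else [::]
  | 0 => [::]
  end.

(* Ulam--Harris labels of vertices 0, ..., k of t, in order of arrival. The vertex
   m.+1 attaches to v := t`_m, to which count_mem v (take m t) vertices have
   attached before. *)
Fixpoint uh_labels_upto (t : attach_tree) (k : nat) : seq (seq nat) :=
  if k is m.+1 then
    let L := uh_labels_upto t m in
    let v := nth 0%N t m in
    rcons L (rcons (nth [::] L v) (count_mem v (take m t)).+1)
  else [:: [::]].

Definition uh_labels (t : attach_tree) : {fset seq nat} :=
  [fset l in uh_labels_upto t (size t)]%fset.

Definition uh_common_size (t1 t2 : attach_tree) : nat :=
  #|` (uh_labels t1 `&` uh_labels t2)%fset |.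

Definition mutually_independent (d : measure_display) (Omega : measurableType d)
    (R : realType) (P : probability Omega R) (d' : measure_display)
    (S : measurableType d') (I : choiceType) (X : I -> {RV P >-> S}) : Prop :=
  forall (J : {fset I}) (B : I -> set S),
    (forall i, i \in J -> measurable (B i)) ->
    P (\bigcap_(i in [set` J]) (X i @^-1` B i)) =
    (\prod_(i <- J) P (X i @^-1` B i))%E.

(* V m is the vertex chosen when passing from the tree with m.+1 vertices to the
   tree with m.+2 vertices. *)
Definition uniform_attachment_choices (d : measure_display)
    (Omega : measurableType d) (R : realType) (P : probability Omega R)
    (V : nat -> {RV P >-> nat}) : Prop :=
  (forall m k : nat, (k < m.+1)%N -> P (V m @^-1` [set k]) = ((m.+1%:R)^-1)%:E) /\
  mutually_independent V.

Definition uniform_attachment_tree (d : measure_display)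
    (Omega : measurableType d) (R : realType) (P : probability Omega R)
    (T : nat -> Omega -> attach_tree) : Prop :=
  exists2 V : nat -> {RV P >-> nat}, uniform_attachment_choices V &
    forall n w, T n w = grow (fun m => V m w) n.

(* Random trees take countably many values, so every set of trees is an event. *)
Definition independent_trees (d : measure_display) (Omega : measurableType d)
    (R : realType) (P : probability Omega R)
    (X Y : Omega -> attach_tree) : Prop :=
  forall A B : set attach_tree,
    P (X @^-1` A `&` Y @^-1` B) = (P (X @^-1` A) * P (Y @^-1` B))%E.

(* Main.v *)
Require Import Defs.
From mathcomp Require Import all_boot all_order all_algebra finmap.
From mathcomp Require Import all_classical all_reals all_analysis.
From mathcomp Require Import ring lra zify.
Import Order.TTheory GRing.Theory Num.Theory.
Import numFieldNormedType.Exports.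
Local Open Scope classical_set_scope.
Local Open Scope ring_scope.
Set Implicit Arguments.
Unset Strict Implicit.
Unset Printing Implicit Defensive.

(** Why the theorem holds.

    In a uniform attachment tree, the subtree hanging from the first child of
    the root and the tree that remains once this subtree is cut off are, given
    their sizes, independent uniform attachment trees, and the size of the first
    one is uniform over its possible values. Cutting two independent trees in
    this way, with sizes [a] and [b], splits their common labels in two groups,
    so the common size satisfies
    [Y(a, b) = Y(I, J) + Y'(a - I, b - J)] in law, with [I] and [J] independent
    and uniform, and [Y = 1] as soon as one of the trees is a single vertex.
    Trees are encoded as binary trees ([bintree]) for which this is a structural
    recursion; the splitting of the law is [mean_tree_node].

    The exponent comes from the mean: if [U], [V] are uniform on [[0, 1]], the
    function [(a b)^s] is preserved by
    [f(a, b) |-> E(f(a U, b V) + f(a (1 - U), b (1 - V)))] exactly when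
    [2 / (1 + s)^2 = 1], that is [s = sqrt 2 - 1], and [(n n)^s] is then
    [n^(2 (sqrt 2 - 1))]. Replacing [k^s] by the generalized binomial
    coefficients [gen_binomial s k] makes this an exact identity for the discrete
    recursion ([mean_gen_binomial]).

    To get a bound in probability one works with the Laplace transform
    [phi(a, b) = E exp(- lam Y(a, b))] at [lam = n^-(exponent)]. The recursion
    gives [phi(a + 1, b + 1)] as the mean of
    [phi(I, J) phi(a - I, b - J)], so [1 - phi] dominates any small function [u]
    that is a subsolution of the linearized recursion with [2] replaced by
    [2 - eta] and that is below [1 - phi] on the boundary
    ([common_laplace_subsolution]). The power function [(a b)^s] with [s]
    slightly below [sqrt 2 - 1] satisfies the recursion but is far too large on
    the boundary, where one tree is trivial and the other may be huge. This is
    cured by subtracting a small multiple of [a^p b^q + a^q b^p], where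
    [p < s < q] and [(1 + p) (1 + q) = 2]: such a term is a supersolution,
    negligible near the diagonal at scale [n], yet dominant far away from the
    diagonal. The outcome is [phi(n, n) <= 1 - c] with a constant [c > 0]
    ([common_laplace_gap]).

    Finally, [phi(a + 1, a + 1) <= phi(m, m)^2 + 4 m / (a + 1)], because both
    parts of both trees have size at least [m] unless one of the uniform splits
    is extreme. Iterating this a bounded number of times drives [phi] from
    [1 - c] below any [rho > 0], at the cost of a bounded factor on [n], which
    the margin in the exponent absorbs ([common_laplace_amplify],
    [common_laplace_vanish]). Markov's inequality for [exp(- lam Y)] then
    concludes ([prob_common_ge]). *)

(** * Attachment trees as binary trees *)

(** Left-child right-sibling encoding: [Leaf] is a single vertex, and [Node A B]
    is a tree whose first child of the root carries [A], while [B] is what remains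
    after removing it. Vertices correspond to leaves, the root being the rightmost
    one, and attaching a new vertex to [v] turns the leaf [v] into
    [Node Leaf Leaf]. *)
Inductive bintree := Leaf | Node (A B : bintree).

(** Passing from the remaining tree [B] to [Node A B] renumbers the children of the
    root, which gain an elder sibling. *)
Definition shift (l : seq nat) := if l is j :: l' then j.+1 :: l' else [::].
Definition unshift (l : seq nat) := if l is j :: l' then j.-1 :: l' else [::].

Fixpoint leaf_labels (b : bintree) : seq (seq nat) :=
  if b is Node A B then
    map (cons 1%N) (leaf_labels A) ++ map shift (leaf_labels B)
  else [:: [::]].

Fixpoint split_leaf (b : bintree) (l : seq nat) : bintree :=
  if b is Node A B then
    if l is 1%N :: l' then Node (split_leaf A l') B
    else Node A (split_leaf B (unshift l))
  else Node Leaf Leaf.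

Fixpoint nb_children (b : bintree) (l : seq nat) : nat :=
  if b is Node A B then
    match l with
    | [::] => (nb_children B [::]).+1
    | 1%N :: l' => nb_children A l'
    | _ => nb_children B (unshift l)
    end
  else 0%N.

Fixpoint common_leaves (b c : bintree) : nat :=
  match b, c with
  | Node A B, Node A' B' => (common_leaves A A' + common_leaves B B')%N
  | _, _ => 1%N
  end.

Lemma shiftK : cancel shift unshift. Proof. by case. Qed.

Lemma leaf_labels_nil b : [::] \in leaf_labels b.
Proof.
elim: b => [//|A _ B IH] /=; rewrite mem_cat; apply/orP; right.
by apply/mapP; exists [::].
Qed.

Lemma leaf_labels_pos b l : 0%N :: l \notin leaf_labels b.
Proof.
case: b => [//|A B] /=; rewrite mem_cat; apply/norP; split.
  by apply/mapP => -[].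
by apply/mapP => -[[|j l']].
Qed.

(** Case analysis on the labels of a node. Labels have positive entries, so a
    label of [B] is either empty or starts with [j.+1], which becomes [j.+2]. *)
Lemma leaf_labels_node (A B : bintree) (P : seq nat -> Prop) :
  (forall l, l \in leaf_labels A -> P (1%N :: l)) ->
  (P [::]) ->
  (forall j l, j.+1 :: l \in leaf_labels B -> P (j.+2 :: l)) ->
  forall l, l \in leaf_labels (Node A B) -> P l.
Proof.
move=> PA P0 PB l /=; rewrite mem_cat => /orP[] /mapP[l' l'in ->]; first exact: PA.
case: l' l'in => [//|[|j] l'] l'in; last exact: PB.
by rewrite (negPf (leaf_labels_pos _ _)) in l'in.
Qed.

Lemma mem_leaf_labels_first A B l :
  (1%N :: l \in leaf_labels (Node A B)) = (l \in leaf_labels A).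
Proof.
rewrite /= mem_cat mem_map; last by move=> ? ? [].
apply/orb_idr => /mapP[[//|j l'] h [hj _]].
by rewrite -hj in h; rewrite (negPf (leaf_labels_pos _ _)) in h.
Qed.

Lemma mem_leaf_labels_rest B l : l \in leaf_labels B ->
  forall A' B', (shift l \in leaf_labels (Node A' B')) = (l \in leaf_labels B').
Proof.
move=> lB A' B'; rewrite /= mem_cat (mem_map (can_inj shiftK)).
apply/orb_idl => /mapP[l' _]; case: l lB => [//|j l] lB [j0 _].
by rewrite j0 (negPf (leaf_labels_pos _ _)) in lB.
Qed.

Lemma leaf_labels_uniq b : uniq (leaf_labels b).
Proof.
elim: b => [//|A IHA B IHB]; rewrite /= cat_uniq.
rewrite (map_inj_uniq (can_inj shiftK)) map_inj_uniq ?IHA ?IHB; last by move=> ? ? [].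
rewrite andbT; apply/hasPn => _ /mapP[l lB ->]; apply/mapP => -[l' _].
case: l lB => [//|j l] lB [j0 _].
by rewrite j0 (negPf (leaf_labels_pos _ _)) in lB.
Qed.

(** The labels common to two nodes are those common to the first subtrees and those
    common to the remaining trees, since a label starting with [1] never coincides
    with a shifted one. Hence the recursive form of [common_leaves]. *)
Lemma count_common b c : count (mem (leaf_labels c)) (leaf_labels b) = common_leaves b c.
Proof.
elim: b c => [|A IHA B IHB] c; first by rewrite /= leaf_labels_nil; case: c.
case: c => [|A' B'].
  rewrite (@eq_count _ _ (pred1 [::])); last by move=> l; rewrite /= inE.
  by rewrite (count_uniq_mem _ (leaf_labels_uniq _)) leaf_labels_nil.
rewrite [RHS]/= -(IHA A') -(IHB B') {2}/leaf_labels -/leaf_labels count_cat !count_map.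
congr addn; apply: eq_in_count => l lin.
  exact: mem_leaf_labels_first.
exact: (mem_leaf_labels_rest lin).
Qed.

Lemma leaf_labels_split b l : l \in leaf_labels b ->
  perm_eq (leaf_labels (split_leaf b l)) (rcons l (nb_children b l).+1 :: leaf_labels b).
Proof.
elim: b l => [|A IHA B IHB]; first by move=> l; rewrite inE => /eqP ->.
apply: leaf_labels_node => [l lA|| j l lB] /=.
- rewrite -cat_cons perm_cat2r; exact: (perm_map (cons 1%N) (IHA _ lA)).
- rewrite perm_sym -cat1s perm_catCA perm_cat2l perm_sym.
  exact: (perm_map shift (IHB _ (leaf_labels_nil B))).
- rewrite perm_sym -cat1s perm_catCA perm_cat2l perm_sym.
  exact: (perm_map shift (IHB _ lB)).
Qed.

Lemma nb_children_split b l0 l : l0 \in leaf_labels b -> l \in leaf_labels b ->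
  nb_children (split_leaf b l0) l = (nb_children b l + (l == l0))%N.
Proof.
elim: b l0 l => [|A IHA B IHB].
  by move=> l0 l; rewrite !inE => /eqP -> /eqP ->.
move=> l0 l l0in lin; move: l0 l0in l lin.
have B0 := leaf_labels_nil B.
apply: leaf_labels_node => [l0 l0A||j0 l0 l0B]; apply: leaf_labels_node => [l lA||j l lB] //=;
  by rewrite ?addn0 ?IHA ?IHB ?eqxx ?addn1 //= ?addn0.
Qed.

Lemma nb_children_new b l : l \in leaf_labels b ->
  nb_children (split_leaf b l) (rcons l (nb_children b l).+1) = 0%N.
Proof.
elim: b l => [|A IHA B IHB]; first by move=> l; rewrite inE => /eqP ->.
apply: leaf_labels_node => [l lA|| j l lB] /=; first exact: IHA.
  exact: (IHB _ (leaf_labels_nil B)).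
exact: (IHB _ lB).
Qed.

Lemma common_leaves_split b l c : (common_leaves b c <= common_leaves (split_leaf b l) c)%N.
Proof.
have c1 : forall b c, (1 <= common_leaves b c)%N.
  by elim=> [|A IHA B IHB] [|A' B'] //=; rewrite addn_gt0 IHA.
elim: b l c => [|A IHA B IHB] l [|A' B'] //.
by case: l => [|[|[|j]] l] /=; rewrite ?leq_add2l ?leq_add2r.
Qed.

Lemma common_leavesC b c : common_leaves b c = common_leaves c b.
Proof. by elim: b c => [|A IHA B IHB] [|A' B'] //=; rewrite IHA IHB. Qed.

Section attach_trees.
Local Open Scope nat_scope.

Definition arrival_labels (t : attach_tree) := uh_labels_upto t (size t).

Lemma takel_rcons (T : Type) (s : seq T) x k : k <= size s ->
  take k (rcons s x) = take k s.
Proof. by move=> ks; rewrite -cats1 takel_cat. Qed.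

Lemma uh_labels_upto_rcons t v k : k <= size t ->
  uh_labels_upto (rcons t v) k = uh_labels_upto t k.
Proof.
elim: k => [//|k IH] kt /=; rewrite IH 1?ltnW// nth_rcons kt.
by rewrite takel_rcons// ltnW.
Qed.

Lemma size_arrival_labels t : size (arrival_labels t) = (size t).+1.
Proof.
by rewrite /arrival_labels; elim: (size t) => [//|m IH] /=; rewrite size_rcons IH.
Qed.

Lemma arrival_labels_rcons t v : arrival_labels (rcons t v) =
  rcons (arrival_labels t) (rcons (nth [::] (arrival_labels t) v) (count_mem v t).+1).
Proof.
rewrite /arrival_labels size_rcons /= uh_labels_upto_rcons// nth_rcons ltnn eqxx.
by rewrite takel_rcons// take_size.
Qed.

(** Replays the attachments on binary trees, the parent being located through its
    label, as arrival order is not visible in a binary tree. *)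
Fixpoint bintree_upto (t : attach_tree) (k : nat) : bintree :=
  if k is m.+1 then
    split_leaf (bintree_upto t m) (nth [::] (uh_labels_upto t m) (nth 0 t m))
  else Leaf.

Definition bintree_of (t : attach_tree) := bintree_upto t (size t).

Lemma bintree_of_rcons t v : bintree_of (rcons t v) =
  split_leaf (bintree_of t) (nth [::] (arrival_labels t) v).
Proof.
have e k : k <= size t -> bintree_upto (rcons t v) k = bintree_upto t k.
  elim: k => [//|k IH] kt /=.
  by rewrite IH 1?ltnW// nth_rcons kt uh_labels_upto_rcons// ltnW.
rewrite /bintree_of size_rcons /= e// nth_rcons ltnn eqxx.
by rewrite uh_labels_upto_rcons.
Qed.

Fixpoint attach_trees (k : nat) : seq attach_tree :=
  if k is m.+1 then [seq rcons t v | t <- attach_trees m, v <- iota 0 m.+1]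
  else [:: [::]].

Lemma attach_treesP k t : t \in attach_trees k ->
  [/\ size t = k & forall m, m < k -> nth 0 t m <= m].
Proof.
elim: k t => [|k IH] t; first by rewrite inE => /eqP ->.
case/allpairsP => -[t' v] [] /IH[st ht]; rewrite mem_iota /= add0n => vk ->.
rewrite size_rcons st; split=> // m; rewrite ltnS leq_eqVlt nth_rcons st.
by move=> /orP[/eqP ->|mk]; [rewrite ltnn eqxx|rewrite mk ht].
Qed.

Lemma attach_trees_uniq k : uniq (attach_trees k).
Proof.
elim: k => [//|k IH]; apply: allpairs_uniq => //; first exact: iota_uniq.
by move=> [t v] [t' v'] _ _ /= /rcons_inj [-> ->].
Qed.

(** The labels given by order of arrival are those of the binary tree. The second
    part is the induction invariant: the number of previous attachments to a vertex,
    which determines the next label, can be read off the binary tree. *)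
Lemma arrival_labelsP k t : t \in attach_trees k ->
  perm_eq (arrival_labels t) (leaf_labels (bintree_of t)) /\
  (forall v, v <= k ->
    count_mem v t = nb_children (bintree_of t) (nth [::] (arrival_labels t) v)).
Proof.
elim: k t => [|k IH] t; first by rewrite inE => /eqP -> /=; split => // -[].
case/allpairsP => -[t' v] [] t'in; rewrite mem_iota /= add0n => vk ->.
have [pt ct] := IH _ t'in; have [st ht] := attach_treesP t'in.
have sL : size (arrival_labels t') = k.+1 by rewrite size_arrival_labels st.
have nL u : u <= k -> nth [::] (arrival_labels t') u \in leaf_labels (bintree_of t').
  by move=> uk; rewrite -(perm_mem pt) mem_nth// sL.
have uL : uniq (arrival_labels t') by rewrite (perm_uniq pt) leaf_labels_uniq.
rewrite arrival_labels_rcons bintree_of_rcons ct//; split.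
  rewrite perm_sym (perm_trans (leaf_labels_split (nL _ vk)))// perm_sym.
  by rewrite perm_rcons perm_cons.
move=> u; rewrite leq_eqVlt nth_rcons sL -cats1 count_cat /= addn0 => /orP[/eqP ->|uk].
  (* the new vertex is nobody's parent, since parents arrive before children *)
  rewrite ltnn eqxx nb_children_new ?nL// (ltn_eqF vk) addn0.
  apply/count_memPn/negP => /(nthP 0)[m]; rewrite st => mk e.
  by have := ht _ mk; rewrite e; lia.
rewrite uk nb_children_split ?nL// -ct// nth_uniq ?sL//.
by rewrite eq_sym.
Qed.

Lemma uh_common_sizeE k l t1 t2 : t1 \in attach_trees k -> t2 \in attach_trees l ->
  uh_common_size t1 t2 = common_leaves (bintree_of t1) (bintree_of t2).
Proof.
move=> /arrival_labelsP[p1 _] /arrival_labelsP[p2 _].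
rewrite -count_common -(permP p1) -size_filter /uh_common_size.
have uL : uniq [seq x <- arrival_labels t1 | x \in leaf_labels (bintree_of t2)].
  by rewrite filter_uniq// (perm_uniq p1) leaf_labels_uniq.
rewrite -(undup_id uL) -card_fseq; congr (#|` _|).
apply/fsetP => x; rewrite !inE /= mem_filter -(perm_mem p2) andbC.
by [].
Qed.

End attach_trees.

(** * The uniform law and its splitting at the root *)

(** The binary trees produced by the [k`!] sequences of [k] attachments, each listed
    once per sequence: averaging over this list is averaging over the law of the
    uniform attachment tree with [k.+1] vertices. *)
Fixpoint bintrees (k : nat) : seq bintree :=
  if k is m.+1 then flatten [seq map (split_leaf b) (leaf_labels b) | b <- bintrees m]
  else [:: Leaf].

Lemma size_leaf_labels_split b l : l \in leaf_labels b ->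
  size (leaf_labels (split_leaf b l)) = (size (leaf_labels b)).+1.
Proof. by move=> lb; rewrite (perm_size (leaf_labels_split lb)). Qed.

Section mean_over_bintrees.
Context {R : realType}.
Implicit Types (G H : bintree -> R) (k : nat).

Lemma sum_bintreesS k G : \sum_(b <- bintrees k.+1) G b =
  \sum_(b <- bintrees k) \sum_(l <- leaf_labels b) G (split_leaf b l).
Proof. by rewrite /= big_flatten big_map; apply: eq_bigr => b _; rewrite big_map. Qed.

Lemma eq_sum_bintrees k G H :
  (forall b, size (leaf_labels b) = k.+1 -> G b = H b) ->
  \sum_(b <- bintrees k) G b = \sum_(b <- bintrees k) H b.
Proof.
elim: k G H => [|k IH] G H GH; first by rewrite !big_seq1 GH.
rewrite !sum_bintreesS; apply: IH => b sb; apply: eq_big_seq => l lb.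
by rewrite GH// size_leaf_labels_split ?sb.
Qed.

Definition mean_tree k G : R := (k`!%:R)^-1 * \sum_(b <- bintrees k) G b.

Lemma eq_mean_tree k G H :
  (forall b, size (leaf_labels b) = k.+1 -> G b = H b) ->
  mean_tree k G = mean_tree k H.
Proof. by move=> GH; congr *%R; exact: eq_sum_bintrees. Qed.

Lemma mean_treeS k G : mean_tree k.+1 G =
  k.+1%:R^-1 * mean_tree k (fun b => \sum_(l <- leaf_labels b) G (split_leaf b l)).
Proof. by rewrite /mean_tree sum_bintreesS factS natrM invfM mulrA. Qed.

Lemma mean_tree0 G : mean_tree 0 G = G Leaf.
Proof. by rewrite /mean_tree big_seq1 invr1 mul1r. Qed.

Lemma mean_treeZ k c G : mean_tree k (fun b => c * G b) = c * mean_tree k G.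
Proof. by rewrite /mean_tree -mulr_sumr mulrCA. Qed.

Lemma mean_treeD k G H : mean_tree k (fun b => G b + H b) = mean_tree k G + mean_tree k H.
Proof. by rewrite /mean_tree big_split mulrDr. Qed.

Lemma mean_tree_sum k (I : Type) (r : seq I) (F : I -> bintree -> R) :
  mean_tree k (fun b => \sum_(i <- r) F i b) = \sum_(i <- r) mean_tree k (F i).
Proof. by rewrite /mean_tree exchange_big /= mulr_sumr. Qed.

Lemma mean_tree_exchange k l (F : bintree -> bintree -> R) :
  mean_tree k (fun b => mean_tree l (F b)) =
  mean_tree l (fun c => mean_tree k (fun b => F b c)).
Proof.
rewrite /mean_tree !mulr_sumr; under eq_bigr do rewrite mulr_sumr mulr_sumr.
under [RHS]eq_bigr do rewrite mulr_sumr mulr_sumr.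
by rewrite exchange_big /=; do 2 apply: eq_bigr => ? _; rewrite mulrCA.
Qed.

Lemma mean_leaf_cst k b (c : R) : size (leaf_labels b) = k.+1 ->
  k.+1%:R^-1 * (\sum_(l <- leaf_labels b) c) = c.
Proof.
by move=> sb; rewrite big_tnth sumr_const card_ord sb -[c *+ _]mulr_natl mulKf// pnatr_eq0.
Qed.

Lemma mean_tree_cst k c : mean_tree k (fun=> c) = c.
Proof.
elim: k => [|k IH]; first by rewrite mean_tree0.
rewrite mean_treeS -[RHS]IH -mean_treeZ; apply: eq_mean_tree => b sb.
exact: mean_leaf_cst.
Qed.

Lemma le_mean_tree k G H : (forall b, G b <= H b) -> mean_tree k G <= mean_tree k H.
Proof.
by move=> GH; rewrite ler_wpM2l ?invr_ge0 ?ler0n//; apply: ler_sum => b _.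
Qed.

(** Polya urn identity: if a pair of sizes adding up to [k.+2] is uniformly
    distributed and one size grows by one with probability proportional to it, the
    new pair is again uniformly distributed. *)
Lemma sum_polya_urn k (u : nat -> nat -> R) :
  \sum_(i < k.+1) (i.+1%:R * u i.+1 (k - i)%N + (k - i).+1%:R * u i (k - i).+1) =
  k.+1%:R * \sum_(i < k.+2) u i (k.+1 - i)%N.
Proof.
rewrite big_split /=.
have -> : \sum_(i < k.+1) i.+1%:R * u i.+1 (k - i)%N =
    \sum_(i < k.+2) i%:R * u i (k.+1 - i)%N.
  by rewrite [RHS]big_ord_recl mul0r add0r; apply: eq_bigr => i _.
have -> : \sum_(i < k.+1) (k - i).+1%:R * u i (k - i).+1 =
    \sum_(i < k.+2) (k.+1 - i)%:R * u i (k.+1 - i)%N.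
  rewrite [RHS]big_ord_recr /= subnn mul0r addr0; apply: eq_bigr => i _.
  by rewrite subSn// -ltnS.
rewrite -big_split mulr_sumr; apply: eq_bigr => i _ /=.
by rewrite -mulrDl -natrD subnKC// -ltnS.
Qed.

(** The two parts of a tree with [k.+2] vertices have uniformly distributed sizes
    and, given these, are independent uniform attachment trees. By induction on
    the growth: the next vertex joins a part with probability proportional to its
    size, at a uniform place of this part. *)
Lemma mean_tree_node k G : mean_tree k.+1 G = k.+1%:R^-1 *
  \sum_(i < k.+1) mean_tree i (fun A => mean_tree (k - i) (fun B => G (Node A B))).
Proof.
elim: k G => [|k IH] G.
  rewrite mean_treeS !mean_tree0 big_ord_recl big_ord0 addr0 !mean_tree0.
  by rewrite big_seq1.
rewrite mean_treeS IH mulrA -invfM -natrM [in RHS]mulrC -[RHS]mulr1.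
pose u i j := mean_tree i (fun A => mean_tree j (fun B => G (Node A B))).
have -> : \sum_(i < k.+1) mean_tree i (fun A => mean_tree (k - i) (fun B =>
    \sum_(l <- leaf_labels (Node A B)) G (split_leaf (Node A B) l))) =
    \sum_(i < k.+1) (i.+1%:R * u i.+1 (k - i)%N + (k - i).+1%:R * u i (k - i).+1).
  apply: eq_bigr => i _; rewrite /u mean_treeS mulVKf ?pnatr_eq0//.
  rewrite -mean_treeZ -mean_treeD; apply: eq_mean_tree => A sA.
  rewrite mean_treeS mulVKf ?pnatr_eq0// -mean_tree_sum -mean_treeD.
  apply: eq_mean_tree => B sB /=; rewrite big_cat !big_map /=; congr +%R.
  apply: eq_big_seq => l lB; case: l lB => [//|[|j] l] lB //=.
  by rewrite (negPf (leaf_labels_pos _ _)) in lB.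
rewrite sum_polya_urn mulr1 natrM invfM -mulrA mulKf ?pnatr_eq0//.
by rewrite mulrC.
Qed.

End mean_over_bintrees.

(** * Laplace transform of the common size *)

Section common_transform.
Context {R : realType}.
Implicit Types (lam eta : R) (a b i j k n : nat) (u v : nat -> nat -> R).

(** Sizes are shifted by one: the trees have [a.+1] and [b.+1] vertices. *)
Definition common_laplace lam a b : R :=
  mean_tree a (fun A => mean_tree b (fun B => expR (- (lam * (common_leaves A B)%:R)))).

Lemma common_laplaceC lam a b : common_laplace lam a b = common_laplace lam b a.
Proof.
rewrite /common_laplace mean_tree_exchange.
by do 2 apply: eq_mean_tree => ? _; rewrite common_leavesC.
Qed.

Lemma common_laplace0r lam a : common_laplace lam a 0 = expR (- lam).
Proof.
rewrite -[RHS](mean_tree_cst a); apply: eq_mean_tree => A _.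
by rewrite mean_tree0 common_leavesC mulr1.
Qed.

Lemma common_laplace_ge0 lam a b : 0 <= common_laplace lam a b.
Proof.
rewrite -[leLHS](mean_tree_cst a); apply: le_mean_tree => A.
by rewrite -[leLHS](mean_tree_cst b); apply: le_mean_tree => B; exact: expR_ge0.
Qed.

(** Growing a tree can only create common labels. *)
Lemma le_common_laplace lam a a' b b' : 0 <= lam -> (a <= a')%N -> (b <= b')%N ->
  common_laplace lam a' b' <= common_laplace lam a b.
Proof.
move=> lam0.
have step c d : common_laplace lam c.+1 d <= common_laplace lam c d.
  rewrite /common_laplace mean_treeS -mean_treeZ.
  rewrite [leRHS](_ : _ = mean_tree c (fun A => c.+1%:R^-1 * \sum_(l <- leaf_labels A)
     mean_tree d (fun B => expR (- (lam * (common_leaves A B)%:R))))); last first.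
    apply: eq_mean_tree => A sA.
    by rewrite mean_leaf_cst.
  apply: le_mean_tree => A; rewrite ler_wpM2l ?invr_ge0 ?ler0n//.
  apply: ler_sum => l _; apply: le_mean_tree => B.
  by rewrite ler_expR lerN2 ler_wpM2l// ler_nat common_leaves_split.
have left c c' d : (c <= c')%N -> common_laplace lam c' d <= common_laplace lam c d.
  by move=> /subnK <-; elim: (_ - _)%N => [//|k IH]; exact: le_trans (step _ _) IH.
move=> aa bb; apply: le_trans (left _ _ b' aa) _.
by rewrite !(common_laplaceC _ a) left.
Qed.

(** Mean over the splits of two trees with [a.+2] and [b.+2] vertices: the first
    parts have [i.+1] and [j.+1] vertices. *)
Definition split_mean a b u : R :=
  (a.+1%:R * b.+1%:R)^-1 * \sum_(i < a.+1) \sum_(j < b.+1) u i j.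

Lemma le_split_mean a b u v : (forall i j, (i <= a)%N -> (j <= b)%N -> u i j <= v i j) ->
  split_mean a b u <= split_mean a b v.
Proof.
move=> uv; rewrite ler_wpM2l ?invr_ge0 ?mulr_ge0//.
by apply: ler_sum => i _; apply: ler_sum => j _; apply: uv; rewrite -ltnS.
Qed.

Lemma split_meanD a b u v :
  split_mean a b (fun i j => u i j + v i j) = split_mean a b u + split_mean a b v.
Proof.
rewrite /split_mean; under eq_bigr do rewrite big_split.
by rewrite big_split /= mulrDr.
Qed.

Lemma split_meanZ a b c u : split_mean a b (fun i j => c * u i j) = c * split_mean a b u.
Proof.
rewrite /split_mean [RHS]mulrCA [in RHS]mulr_sumr; congr *%R; apply: eq_bigr => i _.
by rewrite mulr_sumr.
Qed.

Lemma split_mean_cst a b c : split_mean a b (fun _ _ => c) = c.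
Proof.
rewrite /split_mean; under eq_bigr do rewrite sumr_const card_ord.
by rewrite sumr_const card_ord -mulrnA -[c *+ _]mulr_natl mulnC natrM mulKf//.
Qed.

Lemma split_mean_rev a b u :
  split_mean a b (fun i j => u (a - i)%N (b - j)%N) = split_mean a b u.
Proof.
rewrite /split_mean; congr *%R; rewrite [RHS](reindex_inj rev_ord_inj) /=.
apply: eq_bigr => i _; rewrite [RHS](reindex_inj rev_ord_inj) /=.
by apply: eq_bigr => j _; rewrite !subSS.
Qed.

Lemma split_mean_prod a b (f g : nat -> R) : split_mean a b (fun i j => f i * g j) =
  (a.+1%:R^-1 * \sum_(i < a.+1) f i) * (b.+1%:R^-1 * \sum_(j < b.+1) g j).
Proof. by rewrite [RHS]mulrACA big_distrlr /split_mean invfM. Qed.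

Lemma common_laplaceS lam a b : common_laplace lam a.+1 b.+1 =
  split_mean a b (fun i j =>
    common_laplace lam i j * common_laplace lam (a - i) (b - j)).
Proof.
rewrite /split_mean invfM {1}/common_laplace mean_tree_node -mulrA; congr *%R.
rewrite mulr_sumr; apply: eq_bigr => i _.
transitivity (mean_tree i (fun A => mean_tree (a - i) (fun A' =>
   b.+1%:R^-1 * \sum_(j < b.+1)
     (mean_tree j (fun B => expR (- (lam * (common_leaves A B)%:R))) *
      mean_tree (b - j) (fun B' => expR (- (lam * (common_leaves A' B')%:R))))))).
  do 2 apply: eq_mean_tree => ? _; rewrite mean_tree_node; congr *%R.
  apply: eq_bigr => j _; rewrite mulrC -mean_treeZ; apply: eq_mean_tree => B _.
  rewrite mulrC -mean_treeZ; apply: eq_mean_tree => B' _ /=.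
  by rewrite natrD mulrDr opprD expRD.
under eq_mean_tree do rewrite mean_treeZ.
rewrite mean_treeZ; congr *%R.
under eq_mean_tree do rewrite mean_tree_sum.
rewrite mean_tree_sum; apply: eq_bigr => j _.
rewrite /common_laplace [RHS]mulrC -mean_treeZ; apply: eq_mean_tree => A _.
by rewrite mean_treeZ mulrC.
Qed.

(** Comparison principle. Put [g := max(0, u)]; the recursion for [phi] and the
    induction hypothesis [g <= 1 - phi] give
    [1 - phi >= mean (g + g' - g g') >= (2 - eta) mean g], where [g'] is [g] on the
    complementary split, because [g <= eta]. The positive part costs nothing:
    [(2 - eta) mean g] is nonnegative and dominates [(2 - eta) mean u]. *)
Lemma common_laplace_subsolution lam eta n u : 0 <= eta <= 1 -> 0 <= lam ->
  (forall a b, (a <= n)%N -> (b <= n)%N -> u a b <= eta) ->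
  (forall a, (a <= n)%N -> u a 0%N <= 1 - expR (- lam)) ->
  (forall b, (b <= n)%N -> u 0%N b <= 1 - expR (- lam)) ->
  (forall a b, (a < n)%N -> (b < n)%N -> u a.+1 b.+1 <= (2 - eta) * split_mean a b u) ->
  forall a b, (a <= n)%N -> (b <= n)%N -> u a b <= 1 - common_laplace lam a b.
Proof.
move=> /andP[eta0 eta1] lam0 ueta u0r u0l uS.
pose g a b : R := Num.max 0 (u a b).
suff H a b : (a <= n)%N -> (b <= n)%N -> g a b <= 1 - common_laplace lam a b.
  by move=> a b an bn; apply: le_trans (H _ _ an bn); rewrite le_max lexx orbT.
have lam1 : 0 <= 1 - expR (- lam) by rewrite subr_ge0 -expR0 ler_expR oppr_le0.
elim/ltn_ind: a b => -[|a] IH [|b] an bn.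
- by rewrite common_laplace0r ge_max lam1 u0l.
- by rewrite common_laplaceC common_laplace0r ge_max lam1 u0l.
- by rewrite common_laplace0r ge_max lam1 u0r.
have g01 i j : (i <= n)%N -> (j <= n)%N -> 0 <= g i j <= eta.
  by move=> i_n j_n; rewrite /g le_max lexx ge_max eta0 ueta.
have le1 : common_laplace lam a.+1 b.+1 <=
    split_mean a b (fun i j => (1 - g i j) * (1 - g (a - i)%N (b - j)%N)).
  rewrite common_laplaceS; apply: le_split_mean => i j ia jb.
  have le_g k l : (k <= a)%N -> (l <= b)%N -> common_laplace lam k l <= 1 - g k l.
    move=> ka lb; have : g k l <= 1 - common_laplace lam k l by apply: IH; lia.
    lra.
  by rewrite ler_pM ?common_laplace_ge0// le_g// leq_subr.
have le2 : split_mean a b (fun i j => (1 - g i j) * (1 - g (a - i)%N (b - j)%N)) <=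
    1 - (2 - eta) * split_mean a b g.
  rewrite [leRHS](_ : _ = split_mean a b (fun i j =>
      1 + (- g i j + (eta - 1) * g (a - i)%N (b - j)%N))); last first.
    rewrite split_meanD split_mean_cst split_meanD split_meanZ.
    rewrite (split_mean_rev _ _ g).
    have -> : split_mean a b (fun i j => - g i j) = - split_mean a b g.
      by rewrite -mulN1r -split_meanZ; congr split_mean; apply/funext => i;
         apply/funext => j; rewrite mulN1r.
    ring.
  apply: le_split_mean => i j ia jb.
  have /andP[? ?] : 0 <= g i j <= eta by apply: g01; lia.
  have /andP[? ?] : 0 <= g (a - i)%N (b - j)%N <= eta by apply: g01; lia.
  nra.
have le3 : g a.+1 b.+1 <= (2 - eta) * split_mean a b g.
  have ug : split_mean a b u <= split_mean a b g.
    by apply: le_split_mean => i j _ _; rewrite /g le_max lexx orbT.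
  have g0 : 0 <= split_mean a b g.
    rewrite -[leLHS](split_mean_cst a b); apply: le_split_mean => i j _ _.
    by rewrite /g le_max lexx.
  rewrite {1}/g ge_max; apply/andP; split; first by rewrite mulr_ge0//; lra.
  by apply: le_trans (uS _ _ an bn) _; rewrite ler_wpM2l//; lra.
lra.
Qed.

End common_transform.

(** * Eigenfunctions of the splitting recursion *)

Section gap.
Context {R : realType}.
Implicit Types (s p q : R) (k n : nat).

(** The binomial coefficient [k + s choose k], of order [k^s]; unlike the power
    itself, it is an exact eigenfunction of the averaging operator. *)
Definition gen_binomial s k : R := \prod_(i < k) (1 + s / i.+1%:R).

Lemma gen_binomialS s k : gen_binomial s k.+1 = gen_binomial s k * (1 + s / k.+1%:R).
Proof. exact: big_ord_recr. Qed.

Lemma mean_gen_binomial s k : 0 <= s ->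
  k.+1%:R^-1 * \sum_(i < k.+1) gen_binomial s i = gen_binomial s k.+1 / (1 + s).
Proof.
move=> s0; have s1 : 1 + s != 0 by rewrite gt_eqF// ltr_pwDl.
elim: k => [|k IH].
  rewrite big_ord_recl big_ord0 gen_binomialS /gen_binomial big_ord0.
  by rewrite addr0 invr1 !mul1r mulr1 divff.
have k0 m : m.+1%:R != 0 :> R by rewrite pnatr_eq0.
rewrite big_ord_recr /= (gen_binomialS s k.+1).
have -> : \sum_(i < k.+1) gen_binomial s i = k.+1%:R * (gen_binomial s k.+1 / (1 + s)).
  by rewrite -IH mulVKf.
rewrite -[k.+2%:R]natr1; field.
by rewrite s1 /= gt_eqF//; have := ler0n R k; lra.
Qed.

Lemma gen_binomial_ge1 s k : 0 <= s -> 1 <= gen_binomial s k.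
Proof.
move=> s0; elim: k => [|k IH]; first by rewrite /gen_binomial big_ord0.
by rewrite gen_binomialS mulr_ege1// lerDl divr_ge0.
Qed.

Lemma le_gen_binomial s k n : 0 <= s -> (k <= n)%N -> gen_binomial s k <= gen_binomial s n.
Proof.
move=> s0 /subnK <-; elim: (_ - _)%N => [//|m IH]; apply: le_trans IH _.
rewrite addSn gen_binomialS ler_peMr//; last by rewrite lerDl divr_ge0.
exact: le_trans (gen_binomial_ge1 _ s0).
Qed.

(** Convexity of the exponential between [0] and [y], from its tangent at [s * y]. *)
Lemma expR_mul_le s (y : R) : 0 <= s <= 1 -> expR (s * y) <= 1 + s * (expR y - 1).
Proof.
move=> /andP[s0 s1].
have h1 : expR (s * y) * (1 + (y - s * y)) <= expR y.
  rewrite -[in leRHS](subrK (s * y) y) [in leRHS]addrC expRD.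
  by rewrite ler_wpM2l ?expR_ge0// expR_ge1Dx.
have h0 : expR (s * y) * (1 - s * y) <= 1.
  rewrite -[leRHS](expR0) -(subrr (s * y)) expRD.
  by rewrite ler_wpM2l ?expR_ge0// expR_ge1Dx.
have := ler_wpM2l s0 h1.
have : (1 - s) * (expR (s * y) * (1 - s * y)) <= (1 - s) * 1.
  by rewrite ler_wpM2l// subr_ge0.
nra.
Qed.

Lemma gen_binomial_ge s k : 0 <= s <= 1 -> expR (s * ln k.+1%:R) <= gen_binomial s k.
Proof.
move=> s01; elim: k => [|k IH]; first by rewrite /gen_binomial big_ord0 ln1 mulr0 expR0.
have k0 m : 0 < m.+1%:R :> R by rewrite ltr0n.
have -> : k.+2%:R = k.+1%:R * (1 + k.+1%:R^-1) :> R.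
  by rewrite mulrDr mulr1 divff ?gt_eqF// natr1.
have k1 : 0 < 1 + k.+1%:R^-1 :> R by rewrite ltr_pwDl// invr_ge0.
rewrite lnM ?posrE// mulrDr expRD gen_binomialS ler_pM ?expR_ge0//.
apply: le_trans (expR_mul_le _ s01) _.
by rewrite lnK ?posrE// lerD2l addrC addKr.
Qed.

(** The factor [1 + s / k] is at most [(k / (k - 1))^s], whereas for [0 < s < 1] it
    exceeds [((k + 1) / k)^s]. Hence the induction compares [gen_binomial s k] with
    [k^s] from [k = 1] on, where the constant [exp s] is needed. *)
Lemma gen_binomial_le s k : 0 <= s -> gen_binomial s k <= expR (s * (1 + ln k.+1%:R)).
Proof.
move=> s0; have k0 m : 0 < m.+1%:R :> R by rewrite ltr0n.
suff h m : gen_binomial s m.+1 <= expR (s * (1 + ln m.+1%:R)).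
  exact: le_trans (le_gen_binomial s0 (leqnSn k)) (h k).
elim: m => [|m IH].
  by rewrite gen_binomialS /gen_binomial big_ord0 ln1 addr0 mul1r divr1 mulr1 expR_ge1Dx.
rewrite gen_binomialS.
apply: (@le_trans _ _ (expR (s * (1 + ln m.+1%:R)) * expR (s / m.+2%:R))).
  rewrite ler_pM ?expR_ge1Dx//; last by rewrite addr_ge0 ?divr_ge0.
  exact: le_trans (gen_binomial_ge1 _ s0).
rewrite -expRD ler_expR -mulrDr ler_wpM2l// -addrA lerD2l.
have : ln (m.+1%:R / m.+2%:R) <= - m.+2%:R^-1 :> R.
  have -> : m.+1%:R / m.+2%:R = 1 + - m.+2%:R^-1 :> R.
    by rewrite -[m.+2%:R]natr1; field; rewrite gt_eqF//; have := ler0n R m; lra.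
  by apply: le_ln1Dx; rewrite ltrN2 invf_lt1// ltr1n.
by rewrite lnM ?posrE ?invr_gt0// lnV ?posrE// lerBlDl -lerBrDr.
Qed.

Lemma onem_expRN_ge (x : R) : 0 <= x <= 1 -> x / 2 <= 1 - expR (- x).
Proof.
move=> /andP[x0 x1]; have h : expR (- x) * (1 + x) <= 1.
  by rewrite -[leRHS]expR0 -(addNr x) expRD ler_wpM2l ?expR_ge0// expR_ge1Dx.
have := expR_ge0 (- x); nra.
Qed.

(** With [eta := 2 - (1 + s)^2] and [F x y a b] of order [a^x b^y], the
    subsolution is [u := kap (F s s - nu (F p q + F q p))]. By the choice of [eta] the
    first term is an exact eigenfunction, and [2 - eta <= (1 + p) (1 + q)] makes the
    subtracted ones supersolutions. The constant [kap] normalizes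
    [kap F s s] to [eta] at [(n, n)], where [nu] makes the correction cost one half.

    On the boundary, [u a 0] is positive only if [nu] times [a^q] is less than [a^s],
    so only if [ln (a + 1)] is at most
    [(5 + (p + q - 2 s) ln (n + 1)) / (q - s)]; the hypothesis on [lam] is the
    resulting bound on [u a 0]. *)
Lemma common_laplace_gap_exponents s p q n (lam : R) :
  0 <= s <= 1 -> 0 <= p <= 1 -> 0 <= q <= 1 -> s < q ->
  (1 + p) * (1 + q) = 2 -> (1 + s) ^+ 2 <= 2 -> 0 <= lam <= 1 ->
  expR (1 - 2 * s * ln n.+1%:R
        + s * (1 + (5 + (p + q - 2 * s) * ln n.+1%:R) / (q - s))) <= lam ->
  common_laplace lam n n <= 1 - (2 - (1 + s) ^+ 2) / 2.
Proof.
move=> s01 p01 q01 sq pq s2 lam01.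
have L0 : 0 <= ln n.+1%:R :> R by rewrite ln_ge0// ler1n.
set L : R := ln n.+1%:R in L0 *; move=> lamge.
have /andP[q0 q1] := q01; have /andP[p0 p1] := p01; have /andP[s0 s1] := s01.
pose eta := 2 - (1 + s) ^+ 2; rewrite -/eta.
have eta0 : 0 <= eta by rewrite subr_ge0.
have eta1 : eta <= 1.
  have : 1 <= (1 + s) ^+ 2 by rewrite exprn_ege1// lerDl.
  by rewrite /eta; lra.
have gb0 t k : 0 <= t -> 0 < gen_binomial t k.
  by move=> t0; exact: lt_le_trans ltr01 (gen_binomial_ge1 _ t0).
pose F x y a b := gen_binomial x a * gen_binomial y b.
have F0 x y a b : 0 <= x -> 0 <= y -> 0 < F x y a b by move=> *; rewrite mulr_gt0 ?gb0.
have Fss0 := F0 s s n n s0 s0; have Fpq0 := F0 p q n n p0 q0.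
pose kap := eta / F s s n n; pose nu := F s s n n / (4 * F p q n n).
have kap0 : 0 <= kap by rewrite divr_ge0// ltW.
have nu0 : 0 < nu by rewrite divr_gt0// mulr_gt0// ltr0n.
pose u a b := kap * (F s s a b - nu * (F p q a b + F q p a b)).
have gb00 t : gen_binomial t 0 = 1 by rewrite /gen_binomial big_ord0.
have bd a : (a <= n)%N ->
    kap * (gen_binomial s a - nu * gen_binomial q a) <= 1 - expR (- lam).
  move=> an; have A0 : 0 <= ln a.+1%:R :> R by rewrite ln_ge0// ler1n.
  have := gen_binomial_ge a q01; have := gen_binomial_le a s0.
  set A : R := ln a.+1%:R in A0 *.
  move=> sle qge; have lamh := onem_expRN_ge lam01.
  have [neg|pos] := leP (gen_binomial s a) (nu * gen_binomial q a).
    apply: (@le_trans _ _ 0); last by lra.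
    by rewrite mulr_ge0_le0 ?subr_le0.
  (* [nu] is at least of order [n^(2 s - p - q)] *)
  have Fss : expR (2 * s * L) <= F s s n n.
    have -> : 2 * s * L = s * L + s * L by ring.
    by rewrite expRD ler_pM ?expR_ge0 ?gen_binomial_ge.
  have Fpq : F p q n n <= expR ((p + q) * (1 + L)).
    by rewrite /F mulrDl expRD ler_pM ?gen_binomial_le// ltW// gb0.
  have e1 : 2 <= expR 1 :> R by have := expR_ge1Dx (1 : R); lra.
  have e4 : 4 <= expR 2 :> R.
    have -> : 2 = 1 + 1 :> R by ring.
    by rewrite expRD; nra.
  have nuge : expR (2 * s * L - (2 + (p + q) * (1 + L))) <= nu.
    have Fpq4 : 4 * F p q n n <= expR (2 + (p + q) * (1 + L)).
      by rewrite expRD ler_pM// ltW.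
    rewrite expRD expRN; apply: ler_pM; rewrite ?expR_ge0 ?invr_ge0 ?expR_ge0//.
    rewrite lef_pV2 ?posrE ?expR_gt0//.
    by apply: mulr_gt0 => //; rewrite ltr0n.
  have : expR (2 * s * L - (2 + (p + q) * (1 + L)) + q * A) < expR (s * (1 + A)).
    apply: lt_le_trans sle; apply: le_lt_trans pos.
    by rewrite expRD ler_pM ?expR_ge0.
  rewrite ltr_expR => key.
  have Ale : A <= (5 + (p + q - 2 * s) * L) / (q - s).
    by rewrite ler_pdivlMr ?subr_gt0//; lra.
  apply: le_trans lamh; apply: (@le_trans _ _ (kap * gen_binomial s a)).
    by rewrite ler_wpM2l// gerBl mulr_ge0 ?ltW// gb0.
  apply: (@le_trans _ _ (expR (- (2 * s * L) + s * (1 + A)))).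
    rewrite expRD expRN; apply: ler_pM => //; first by rewrite ltW// gb0.
    rewrite -[leRHS]mul1r; apply: ler_pM => //; first by rewrite invr_ge0 ltW.
    by rewrite lef_pV2 ?posrE ?expR_gt0.
  rewrite ler_pdivlMr//; apply: le_trans lamge.
  apply: (@le_trans _ _ (expR (- (2 * s * L) + s * (1 + A)) * expR 1)).
    by rewrite ler_wpM2l ?expR_ge0.
  rewrite -expRD ler_expR.
  by have := ler_wpM2l s0 Ale; lra.
have uS a b : (a < n)%N -> (b < n)%N -> u a.+1 b.+1 <= (2 - eta) * split_mean a b u.
  move=> _ _.
  have sF x y : 0 <= x -> 0 <= y ->
      split_mean a b (F x y) = F x y a.+1 b.+1 / ((1 + x) * (1 + y)).
    by move=> x0 y0; rewrite split_mean_prod !mean_gen_binomial// mulf_div.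
  have -> : split_mean a b u =
      kap * (split_mean a b (F s s) - nu * (split_mean a b (F p q) + split_mean a b (F q p))).
    rewrite split_meanZ split_meanD; congr (_ * (_ + _)).
    by rewrite -split_meanD -mulNr -split_meanZ; congr split_mean;
       apply/funext => i; apply/funext => j; rewrite mulNr.
  rewrite !sF// [(1 + q) * (1 + p)]mulrC pq mulrCA ler_wpM2l//.
  have -> : 2 - eta = (1 + s) * (1 + s) by rewrite /eta; ring.
  have s1' : 1 + s != 0 by rewrite gt_eqF//; lra.
  rewrite mulrBr [_ * (F s s _ _ / _)]mulrCA divff ?mulf_neq0// mulr1 lerD2l lerN2.
  have Fp : 0 < nu * (F p q a.+1 b.+1 + F q p a.+1 b.+1).
    by rewrite mulr_gt0// addr_gt0// F0.
  rewrite -mulrDl mulrA mulrCA ger_pMr// ler_pdivrMr// mul1r.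
  by rewrite -expr2.
have := @common_laplace_subsolution R lam eta n u _ _ _ _ _ uS n n (leqnn n) (leqnn n).
have -> : u n n = eta / 2.
  have e : F q p n n = F p q n n by rewrite /F mulrC.
  by rewrite /u e /kap /nu; field; rewrite !gt_eqF.
have /andP[lam0 lam1] := lam01.
have Fp0 a b : 0 <= nu * (F p q a b + F q p a b).
  by rewrite mulr_ge0 ?addr_ge0// ltW// F0.
move=> H; rewrite lerBrDr -lerBrDl; apply: H => //.
- by rewrite eta0.
- move=> a b an bn; apply: (@le_trans _ _ (kap * F s s a b)).
    by rewrite ler_wpM2l// gerBl.
  apply: (@le_trans _ _ (kap * F s s n n)); last by rewrite divfK// gt_eqF.
  by rewrite ler_wpM2l// ler_pM ?le_gen_binomial// ltW// gb0.
- move=> a an; apply: le_trans (bd _ an); rewrite ler_wpM2l// /F !gb00 !mulr1 lerD2l lerN2.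
  by rewrite ler_wpM2l ?(ltW nu0)// lerDr ltW// gb0.
- move=> a an; apply: le_trans (bd _ an); rewrite ler_wpM2l// /F !gb00 !mul1r lerD2l lerN2.
  by rewrite ler_wpM2l ?(ltW nu0)// lerDl ltW// gb0.
Qed.

End gap.

(** Choice of exponents: [1 + q = r (1 + d)], [1 + p = r / (1 + d)] and
    [1 + s = r (1 - d^2)] with [r = sqrt 2] and [d] of order [eps]. Then
    [p + q - 2 s] is of order [d^2] while [q - s] is of order [d], so the loss on the
    boundary is only [n^O(d)]. *)
Lemma common_laplace_gap (R : realType) (eps : R) : 0 < eps <= 1 ->
  exists2 c : R, 0 < c <= 1 / 2 & exists C : R, forall n lam, 0 <= lam <= 1 ->
    expR (C - (2 * (Num.sqrt 2 - 1) - eps) * ln n.+1%:R) <= lam ->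
    common_laplace lam n n <= 1 - c.
Proof.
move=> /andP[eps0 eps1]; set r := Num.sqrt 2.
have r0 : 0 <= r by exact: sqrtr_ge0.
have r2 : r * r = 2 by rewrite -expr2 sqr_sqrtr.
have [rl ru] : 141 / 100 <= r /\ r <= 142 / 100 by split; nra.
pose d := eps / 8; pose w := (1 + d)^-1.
have d0 : 0 < d by rewrite /d; lra.
have d1 : d <= 1 / 8 by rewrite /d; lra.
have -> : eps = 8 * d by rewrite /d; field.
have wd : w * (1 + d) = 1 by rewrite mulVf// gt_eqF//; lra.
clearbody w d.
have w0 : 0 <= w by nra.
have w1 : w <= 1 by nra.
have w2 : 8 / 9 <= w by nra.
pose q := r * (1 + d) - 1; pose p := r * w - 1; pose s := r * (1 - d ^+ 2) - 1.
have dd0 : 0 < d ^+ 2 by rewrite exprn_gt0.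
have dd1 : d ^+ 2 <= d / 8 by rewrite expr2; nra.
have q01 : 0 <= q <= 1 by rewrite /q; apply/andP; split; nra.
have p01 : 0 <= p <= 1 by rewrite /p; apply/andP; split; nra.
have s01 : 0 <= s <= 1 by rewrite /s; apply/andP; split; nra.
have pq : (1 + p) * (1 + q) = 2.
  have -> : (1 + p) * (1 + q) = (r * r) * (w * (1 + d)) by rewrite /p /q; ring.
  by rewrite r2 wd mulr1.
have s2 : (1 + s) ^+ 2 = 2 * (1 - d ^+ 2) ^+ 2.
  have -> : (1 + s) ^+ 2 = (r * r) * (1 - d ^+ 2) ^+ 2 by rewrite /s; ring.
  by rewrite r2.
have ss : (1 - d ^+ 2) ^+ 2 < 1 by rewrite expr2; nra.
have ss1 : 1 / 2 <= (1 - d ^+ 2) ^+ 2 by rewrite expr2; nra.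
have qs : q - s = r * (d + d ^+ 2) by rewrite /q /s; ring.
have pqs : p + q - 2 * s <= 3 * r * d ^+ 2.
  have h : w - 1 + d <= d ^+ 2.
    have -> : w - 1 + d = d * (1 - w) by lra.
    by rewrite expr2 ler_wpM2l ?ltW//; nra.
  by have := ler_wpM2l r0 h; rewrite /p /q /s; lra.
have r1 : 0 < r by apply: lt_le_trans rl; rewrite divr_gt0.
have qs0 : 0 < q - s by rewrite qs mulr_gt0// addr_gt0.
exists ((2 - (1 + s) ^+ 2) / 2); first by rewrite s2; apply/andP; split; lra.
exists (2 + 5 / d) => n lam lam01 lamge.
have L0 : 0 <= ln n.+1%:R :> R by rewrite ln_ge0// ler1n.
set L : R := ln n.+1%:R in lamge L0 *.
have sq : s < q by rewrite -subr_gt0.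
apply: (common_laplace_gap_exponents s01 p01 q01 sq pq _ lam01).
  by rewrite s2; lra.
apply: le_trans lamge; rewrite ler_expR -/L.
set A := (_ / (q - s)).
have /andP[s0 s1] := s01.
have d5 : 0 < 5 / d by rewrite divr_gt0.
have dL : 0 <= d * L by rewrite mulr_ge0// ltW.
have Ale : A <= 5 / d + 3 * d * L.
  rewrite ler_pdivrMr// qs.
  have -> : (5 / d + 3 * d * L) * (r * (d + d ^+ 2)) =
    5 * r * (1 + d) + 3 * r * d ^+ 2 * L + 3 * r * d ^+ 2 * (d * L).
    by field; rewrite gt_eqF.
  have : (p + q - 2 * s) * L <= 3 * r * d ^+ 2 * L by rewrite ler_wpM2r.
  have : 0 <= 3 * r * d ^+ 2 * (d * L) by rewrite !mulr_ge0// ltW.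
  have : 1 <= r * (1 + d) by nra.
  lra.
have sA : s * (1 + A) <= 1 + (5 / d + 3 * d * L).
  apply: (@le_trans _ _ (s * (1 + (5 / d + 3 * d * L)))).
    by rewrite ler_wpM2l// lerD2l.
  by rewrite ler_piMl//; lra.
have : 2 * s * L = 2 * (r - 1) * L - 2 * (r * d ^+ 2 * L) by rewrite /s; ring.
have : r * d ^+ 2 * L <= d * L by rewrite ler_wpM2r//; nra.
by move: (5 / d) sA => x sA; lra.
Qed.

(** * From a gap to convergence to zero *)

Section amplification.
Context {R : realType}.
Implicit Types (lam c rho : R).

Lemma sum_ltn_le (m n : nat) : \sum_(i < n) (i < m)%:R <= m%:R :> R.
Proof.
rewrite -natr_sum ler_nat; apply: (@leq_trans (minn n m)); last exact: geq_minr.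
elim: n => [|n IH]; first by rewrite big_ord0.
by rewrite big_ord_recr /=; apply: leq_trans (leq_add IH (leqnn _)) _; lia.
Qed.

(** If all four parts have more than [m] vertices, monotonicity bounds both factors
    of the recursion by [phi(m, m)]. Each of the four parts fails this with
    probability at most [m / (a + 1)]. *)
Lemma common_laplace_square lam (a m : nat) : 0 <= lam ->
  common_laplace lam a.+1 a.+1 <=
  4 * m%:R / a.+1%:R + common_laplace lam m m ^+ 2.
Proof.
move=> lam0; pose x := common_laplace lam m m.
pose f (i : nat) : R := (i < m)%:R.
have le1 i j : common_laplace lam i j <= 1.
  apply: le_trans (le_common_laplace lam0 (leq0n i) (leq0n j)) _.
  by rewrite common_laplace0r -[leRHS]expR0 ler_expR oppr_le0.
rewrite common_laplaceS; apply: (@le_trans _ _ (split_mean a a (fun i j =>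
    (f i * 1 + f (a - i)%N * 1) + (1 * f j + 1 * f (a - j)%N) + x ^+ 2))).
  apply: le_split_mean => i j _ _; rewrite /f !mulr1 !mul1r.
  have x2 : 0 <= x ^+ 2 by rewrite exprn_ge0// common_laplace_ge0.
  have l1 : common_laplace lam i j * common_laplace lam (a - i) (a - j) <= 1.
    by rewrite mulr_ile1// common_laplace_ge0.
  case: ltnP => im /=; first by have := ler0n R; move=> h; rewrite -!addrA;
    apply: le_trans l1 _; rewrite lerDl !addr_ge0.
  case: ltnP => aim /=; first by rewrite add0r -!addrA;
    apply: le_trans l1 _; rewrite lerDl !addr_ge0.
  case: ltnP => jm /=; first by rewrite !add0r -!addrA;
    apply: le_trans l1 _; rewrite lerDl !addr_ge0.
  case: ltnP => ajm /=; first by rewrite !add0r;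
    apply: le_trans l1 _; rewrite lerDl.
  by rewrite !add0r expr2 ler_pM ?common_laplace_ge0 ?le_common_laplace.
rewrite !split_meanD split_mean_cst lerD2r.
rewrite (split_mean_rev a a (fun i _ => f i * 1)) (split_mean_rev a a (fun _ j => 1 * f j)).
rewrite (split_mean_prod a a f (fun=> 1)) (split_mean_prod a a (fun=> 1) f).
rewrite sumr_const card_ord mulVf ?pnatr_eq0// mulr1 mul1r.
have : a.+1%:R^-1 * \sum_(i < a.+1) f i <= m%:R / a.+1%:R.
  by rewrite mulrC ler_wpM2r ?invr_ge0// sum_ltn_le.
by rewrite -mulrA; move: (_^-1 * _) (m%:R / _) => S T; lra.
Qed.

(** Write [x_i] for [phi] at size about [(D + 1)^i m]. Then
    [x_{i+1} <= x_i^2 + tau <= (1 - c) x_i + tau], where [tau >= 4 / D] is small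
    compared with [c], so [x_i <= (1 - c)^i + tau / c]; [D] and the number of steps
    depend on [c] and [rho] only. *)
Lemma common_laplace_amplify c rho : 0 < c <= 1 / 2 -> 0 < rho ->
  exists2 K : nat, (0 < K)%N & forall lam m a, 0 <= lam ->
    common_laplace lam m m <= 1 - c -> (K * m.+1 <= a.+1)%N ->
    common_laplace lam a a <= rho.
Proof.
move=> /andP[c0 c1] rho0.
have c2 : 0 <= c / 2 by lra.
pose tau := c / 2 * Num.min 1 rho.
have tau0 : 0 < tau by rewrite mulr_gt0 ?divr_gt0// lt_min ltr01.
have tau1 : tau <= c / 2 by rewrite /tau ler_piMr// ge_min lexx.
have tau2 : tau <= c / 2 * rho.
  by rewrite /tau ler_wpM2l// ge_min lexx orbT.
pose D := Num.bound (4 / tau).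
have D0 : 4 / tau < D%:R by apply: archi_boundP; rewrite divr_ge0// ltW.
have Dp : 0 < D%:R :> R by apply: lt_trans D0; rewrite divr_gt0.
have [j jP] : exists j, (1 - c) ^+ j <= rho / 2.
  have : ((1 - c) ^+ n @[n --> \oo] --> 0)%classic.
    by apply: cvg_expr; rewrite ger0_norm; lra.
  move=> /cvgrPdist_le /(_ (rho / 2)) []; first by rewrite divr_gt0.
  move=> N _ /(_ N (leqnn N)) /=; rewrite sub0r normrN => h; exists N.
  exact: le_trans (ler_norm _) h.
exists (D.+1 ^ j)%N; first by rewrite expn_gt0.
move=> lam m a lam0 gap ja.
suff H i : exists2 b, (b.+1 <= D.+1 ^ i * m.+1)%N &
    common_laplace lam b b <= 1 - c /\
    common_laplace lam b b <= (1 - c) ^+ i + tau / c.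
  have [b bj [_ bc]] := H j.
  have ba : (b <= a)%N by rewrite -ltnS; exact: leq_trans bj ja.
  apply: le_trans (le_common_laplace lam0 ba ba) _; apply: le_trans bc _.
  have : tau / c <= rho / 2 by rewrite ler_pdivrMr//; lra.
  lra.
elim: i => [|i [b bi [b1 b2]]].
  exists m; first by rewrite mul1n.
  have : 0 <= tau / c by rewrite divr_ge0// ltW.
  by split=> //; rewrite expr0; lra.
have Dn : (0 < D)%N by rewrite -(ltr0n R).
exists (D * b.+1)%N.
  rewrite expnS -mulnA; apply: leq_trans (leq_mul (leqnn D.+1) bi).
  by rewrite mulSn -add1n leq_add2r.
have [d dE] : exists d, (D * b.+1)%N = d.+1.
  by exists (D * b.+1).-1; rewrite prednK// muln_gt0 Dn.
have x0 := common_laplace_ge0 lam b b.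
have : common_laplace lam (D * b.+1) (D * b.+1) <= tau + common_laplace lam b b ^+ 2.
  rewrite dE; apply: le_trans (common_laplace_square _ b lam0) _; rewrite lerD2r -dE.
  rewrite natrM ler_pdivrMr ?mulr_gt0// mulrA.
  have : 4 <= tau * D%:R by rewrite mulrC -ler_pdivrMr// ltW.
  have : b%:R <= b.+1%:R :> R by rewrite ler_nat.
  have : 0 <= b%:R :> R by [].
  nra.
set y := common_laplace _ _ _; set x := common_laplace _ _ _ in b1 b2 x0 * => yx.
have xx : x ^+ 2 <= (1 - c) * x by rewrite expr2 ler_wpM2r.
split; first by nra.
have : (1 - c) * x <= (1 - c) ^+ i.+1 + (tau / c - tau).
  rewrite exprS; have -> : tau / c - tau = (1 - c) * (tau / c) by field; rewrite gt_eqF.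
  by rewrite -mulrDr ler_wpM2l//; lra.
lra.
Qed.

(** The gap is applied with exponent margin [eps / 2] at size [m], a bounded factor
    [K] below [n]; the other half of the margin beats both [K] and the constant [C]
    for large [n]. *)
Lemma common_laplace_vanish (eps rho : R) : 0 < eps <= 1 / 10 -> 0 < rho ->
  exists N : nat, forall n, (N <= n)%N ->
    common_laplace (expR (- ((2 * (Num.sqrt 2 - 1) - eps) * ln n.+1%:R))) n n <= rho.
Proof.
move=> /andP[eps0 eps1] rho0; set al := 2 * (Num.sqrt 2 - 1).
have al1 : 1 / 10 <= al <= 1.
  have r2 : Num.sqrt 2 * Num.sqrt 2 = 2 :> R by rewrite -expr2 sqr_sqrtr.
  have r0 : 0 <= Num.sqrt 2 :> R by exact: sqrtr_ge0.
  by rewrite /al; move: (Num.sqrt 2) r0 r2 => r r0 r2; apply/andP; split; nra.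
have [|c c01 [C HC]] := @common_laplace_gap R (eps / 2).
  by rewrite divr_gt0//; lra.
have [K K0 HK] := common_laplace_amplify c01 rho0.
(* since [n.+1 <= 2 K m1.+1], the value [B] of [ln n.+1] is where
   [eps / 2 * ln m1.+1] exceeds [ln (2 K) + C] *)
pose B := ln (2 * K)%:R + 2 * (ln (2 * K)%:R + C) / eps : R.
exists (K + Num.bound (expR B))%N => n nN.
have [m1 mE] : exists m, (n.+1 %/ K)%N = m.+1.
  exists (n.+1 %/ K).-1; rewrite prednK// divn_gt0//; lia.
have nlt : (n.+1 < K * m1.+2)%N by rewrite mulnC -ltn_divLR// mE.
have nge : (K * m1.+1 <= n.+1)%N by rewrite -mE mulnC leq_trunc_div.
have /andP[al0 al2] := al1.
have L0 : 0 <= ln n.+1%:R :> R by rewrite ln_ge0// ler1n.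
have LB : B <= ln n.+1%:R.
  rewrite -[leLHS]expRK ler_ln ?posrE ?expR_gt0//.
  apply: (@le_trans _ _ (Num.bound (expR B))%:R).
    by apply/ltW/archi_boundP; exact: expR_ge0.
  by rewrite ler_nat; apply: leq_trans (leqnSn n); apply: leq_trans nN; exact: leq_addl.
have Lm : ln n.+1%:R <= ln (2 * K)%:R + ln m1.+1%:R :> R.
  rewrite -lnM ?posrE ?ltr0n ?muln_gt0//.
  rewrite ler_ln ?posrE ?mulr_gt0 ?ltr0n ?muln_gt0// -natrM ler_nat.
  apply: leq_trans (ltnW nlt) _; rewrite [(2 * K)%N]mulnC -mulnA leq_mul2l; apply/orP; right.
  by rewrite mul2n -addnn addnS addSn !ltnS leq_addl.
apply: HK nge; first exact: expR_ge0.
apply: HC.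
  by rewrite expR_ge0 -[leRHS]expR0 ler_expR oppr_le0 mulr_ge0//; lra.
rewrite ler_expR -/al.
have : 0 <= ln (2 * K)%:R :> R by rewrite ln_ge0// ler1n muln_gt0.
set L := ln n.+1%:R in L0 LB Lm *; set M := ln m1.+1%:R in Lm *.
rewrite /B in LB; set T := ln (2 * K)%:R in LB Lm * => T0.
have key : T + C <= eps / 2 * M.
  have : 2 * (T + C) / eps <= M by lra.
  by rewrite ler_pdivrMr//; lra.
have : (al - eps) * L <= (al - eps) * (T + M) by rewrite ler_wpM2l//; lra.
have : (al - eps) * T <= T by rewrite ler_piMl//; lra.
lra.
Qed.

End amplification.

(** * Random attachment trees *)

Lemma grow_mkseq (c : nat -> nat) k : grow c k.+1 = mkseq c k.
Proof.
by elim: k => [//|k IH]; rewrite mkseqS -IH.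
Qed.

(** Choosing a parent uniformly by order of arrival or by label amounts to the
    same. *)
Lemma sum_attach_trees (R : realType) k (G : bintree -> R) :
  \sum_(t <- attach_trees k) G (bintree_of t) = \sum_(b <- bintrees k) G b.
Proof.
elim: k G => [|k IH] G; first by rewrite !big_seq1.
rewrite sum_bintreesS -IH big_allpairs_dep /=; apply: eq_big_seq => t tin.
have [pt _] := arrival_labelsP tin; have [st _] := attach_treesP tin.
rewrite -(perm_big _ pt) /=.
have sL : size (arrival_labels t) = k.+1 by rewrite size_arrival_labels st.
rewrite (big_nth [::]) sL big_mkord -[0%N :: _]/(iota 0 k.+1) -val_enum_ord big_map.
rewrite big_enum /=.
by apply: eq_bigr => i _; rewrite bintree_of_rcons.
Qed.

Section law.
Context d (Omega : measurableType d) (R : realType) (P : probability Omega R).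

Lemma measurable_tree (T : nat -> Omega -> attach_tree) n (A : set attach_tree) :
  uniform_attachment_tree P T -> measurable (T n @^-1` A).
Proof.
move=> [V _ TV]; have -> : T n = fun w => grow (fun m => V m w) n.
  by apply/funext => w; rewrite TV.
have mcst t (B : set attach_tree) : measurable ((fun _ : Omega => t) @^-1` B).
  by rewrite preimage_cst; case: ifP.
case: n => [|k]; first exact: mcst.
elim: k A => [|k IH] A; first exact: mcst.
have -> : (fun w => grow (fun m => V m w) k.+2) @^-1` A =
  \bigcup_(v : nat) ((V k @^-1` [set v]) `&`
    ((fun w => grow (fun m => V m w) k.+1) @^-1` [set t | A (attach t v)])).
  apply/seteqP; split => [w Aw|w [v _ [/= <-]]//].
  by exists (V k w).
apply: bigcupT_measurable => v; apply: measurableI; last exact: IH.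
by rewrite -[_ @^-1` _]setTI; exact: measurable_funP.
Qed.

Lemma tree_law (T : nat -> Omega -> attach_tree) k t :
  uniform_attachment_tree P T -> t \in attach_trees k ->
  P (T k.+1 @^-1` [set t]) = ((k`!%:R)^-1)%:E.
Proof.
move=> [V [Vu Vi] TV] /attach_treesP[st ht].
have -> : T k.+1 @^-1` [set t] =
    \bigcap_(i in [set` [fset i in iota 0 k]%fset]) (V i @^-1` [set nth 0%N t i]).
  apply/seteqP; split => w /=; rewrite TV grow_mkseq.
    move=> <- i /=; rewrite !inE mem_iota /= add0n => ik.
    by rewrite nth_mkseq.
  move=> H; apply: (@eq_from_nth _ 0%N); rewrite size_mkseq// => i ik.
  by rewrite nth_mkseq// H//= !inE mem_iota.
rewrite Vi; last by move=> i _ /=.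
rewrite (perm_big (iota 0 k)) /=; last first.
  apply: uniq_perm; rewrite ?fset_uniq ?iota_uniq// => i.
  by rewrite !inE.
have {st} : (k <= k)%N by [].
elim: {1 3 4}k => [|m IH] mk; first by rewrite big_nil invr1.
rewrite -addn1 iotaD big_cat IH 1?ltnW// big_seq1 add0n Vu; last by rewrite ltnS ht.
by rewrite addn1 factS natrM invfM mulrC EFinM.
Qed.

(** The event is a countable union over the values of the two trees. *)
Lemma measurable_common_ge (T1 T2 : nat -> Omega -> attach_tree) (x : R) n :
  uniform_attachment_tree P T1 -> uniform_attachment_tree P T2 ->
  measurable [set w | x <= (uh_common_size (T1 n w) (T2 n w))%:R].
Proof.
move=> h1 h2; rewrite (_ : [set w | _] = \bigcup_p
    ((T1 n @^-1` [set p.1] `&` T2 n @^-1` [set p.2]) `&`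
     [set _ | x <= (uh_common_size p.1 p.2)%:R])); last first.
  apply/seteqP; split => [w Ew|w [[t1 t2] _ [[/= <- <-]]]//].
  by exists (T1 n w, T2 n w).
apply: countable_bigcupT_measurable => [|p]; first exact: countableP.
apply: measurableI; first by apply: measurableI; exact: measurable_tree.
case: (x <= _).
  by rewrite (_ : [set _ | _] = setT)//; apply/seteqP; split.
by rewrite (_ : [set _ | _] = set0)//; apply/seteqP; split.
Qed.

(** Markov's inequality for [exp (- Y / x)], in the form
    [1 - e exp (- y / x) <= 1_(x <= y)]. The finitely many pairs of
    admissible trees carry total mass one, so summing over them suffices. *)
Lemma prob_common_ge (T1 T2 : nat -> Omega -> attach_tree) k (x : R) :
  uniform_attachment_tree P T1 -> uniform_attachment_tree P T2 ->
  independent_trees P (T1 k.+1) (T2 k.+1) -> 0 < x ->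
  ((1 - expR 1 * common_laplace x^-1 k k)%:E <=
   P [set w | (x <= (uh_common_size (T1 k.+1 w) (T2 k.+1 w))%:R)%R])%E.
Proof.
move=> h1 h2 hind x0; set E := [set w | _].
pose F (p : attach_tree * attach_tree) :=
  T1 k.+1 @^-1` [set p.1] `&` T2 k.+1 @^-1` [set p.2].
have mF p : measurable (F p) by apply: measurableI; exact: measurable_tree.
have mE : measurable E by exact: (measurable_common_ge x k.+1 h1 h2).
pose s := [seq p <- [seq (t1, t2) | t1 <- attach_trees k, t2 <- attach_trees k] |
  x <= (uh_common_size p.1 p.2)%:R].
have us : uniq s.
  rewrite filter_uniq// allpairs_uniq ?attach_trees_uniq//.
  by move=> [? ?] [? ?] _ _ [-> ->].
have sE : \bigcup_(p in [set` s]) F p `<=` E.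
  by move=> w [[t1 t2] /=]; rewrite mem_filter => /andP[xs _] [/= e1 e2]; rewrite /E /= e1 e2.
apply: le_trans (le_measure _ _ _ sE); rewrite ?inE//; last first.
  by apply: fin_bigcup_measurable.
have fs : finite_set [set` s] by exact: finite_seq.
rewrite measure_fin_bigcup//; last first.
  by move=> [a b] [a' b'] _ _ [w [[/= <- <-] [/= <- <-]]].
rewrite [leRHS](_ : _ = \sum_(p <- s) P (F p))%E; last exact/esym/fsbig_seq.
rewrite big_filter big_mkcond big_allpairs_dep /=.
pose ind (A B : bintree) : R := (x <= (common_leaves A B)%:R)%R%:R.
rewrite [leRHS](_ : _ = (mean_tree k (fun A => mean_tree k (ind A)))%:E).
  rewrite lee_fin /common_laplace.
  rewrite [leLHS](_ : _ = mean_tree k (fun A => mean_tree k (fun B =>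
    1 + - expR 1 * expR (- (x^-1 * (common_leaves A B)%:R))))); last first.
    under [RHS]eq_mean_tree do rewrite mean_treeD mean_tree_cst mean_treeZ.
    by rewrite mean_treeD mean_tree_cst mean_treeZ mulNr.
  apply: le_mean_tree => A; apply: le_mean_tree => B; rewrite /ind.
  rewrite mulNr -expRD; have [h|h] := leP x (common_leaves A B)%:R; first by rewrite gerBl expR_ge0.
  rewrite subr_le0 -[leLHS]expR0 ler_expR subr_ge0 mulrC ler_pdivrMr// mul1r.
  exact: ltW.
rewrite /mean_tree -sum_attach_trees mulr_sumr -sumEFin.
apply: eq_big_seq => t1 t1in.
rewrite -sum_attach_trees !mulr_sumr -sumEFin.
apply: eq_big_seq => t2 t2in; rewrite /ind -(uh_common_sizeE t1in t2in).
case: ifP => _; last by rewrite !mulr0.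
have := hind [set t1] [set t2].
by rewrite (tree_law h1 t1in) (tree_law h2 t2in) mulr1.
Qed.

End law.

(** * The theorem *)

(** Large [eps] reduces to [eps <= 1 / 10], as the event only grows when the
    exponent decreases. *)
Lemma cvg_prob_common (d : measure_display) (Omega : measurableType d)
    (R : realType) (P : probability Omega R)
    (T1 T2 : nat -> Omega -> attach_tree) (eps : R) :
  uniform_attachment_tree P T1 -> uniform_attachment_tree P T2 ->
  (forall n : nat, (0 < n)%N -> independent_trees P (T1 n) (T2 n)) -> 0 < eps ->
  (fun n : nat =>
     P [set w | n%:R `^ (2 * (Num.sqrt 2 - 1) - eps)
                <= (uh_common_size (T1 n w) (T2 n w))%:R :> R])
    @ \oo --> 1%E.
Proof.
move=> hT1 hT2 hind eps0; set al := 2 * (Num.sqrt 2 - 1).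
have mE n (x : R) := measurable_common_ge x n hT1 hT2.
pose e := Num.min eps (1 / 10).
have e0 : 0 < e <= 1 / 10 by rewrite lt_min eps0 ge_min lexx orbT divr_gt0.
apply/fine_cvgP; split; first by apply: nearW => n; apply: fin_num_measure.
apply/cvgrPdist_le => rho rho0.
have rho1 : 0 < rho / expR 1 by rewrite divr_gt0 ?expR_gt0.
have [N HN] := common_laplace_vanish e0 rho1.
exists N.+1 => // -[//|n] /= nN; set E := [set w | _].
have mE' : measurable E by exact: mE.
have P1 : (P E <= 1)%E by exact: probability_le1.
have n0 : 0 < n.+1%:R :> R by rewrite ltr0n.
have x0 : 0 < n.+1%:R `^ (al - e) :> R by rewrite powR_gt0.
have := prob_common_ge hT1 hT2 (hind n.+1 isT) x0.
set E' := [set w | _]; have mE'' : measurable E' by exact: mE.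
have E'E : E' `<=` E.
  move=> w; rewrite /E /E' /=; apply: le_trans; rewrite ler_powR ?ler1n// lerD2l lerN2.
  by rewrite ge_min lexx.
rewrite (_ : _^-1 = expR (- ((al - e) * ln n.+1%:R))); last first.
  by rewrite expRN /powR gt_eqF.
have := HN n nN; rewrite -/al; set x := common_laplace _ _ _ => xle PE'.
have PE : ((1 - expR 1 * x)%:E <= P E)%E.
  by apply: le_trans PE' _; apply: le_measure => //; rewrite inE.
have fE : P E \is a fin_num by exact: fin_num_measure.
move: P1 PE; rewrite -(fineK fE) !lee_fin => p1 pE.
rewrite ger0_norm ?subr_ge0// lerBlDl -lerBlDr; apply: le_trans pE.
by rewrite lerD2l lerN2 mulrC -ler_pdivlMr ?expR_gt0.
Qed.

Theorem theorem4p1 (d : measure_display) (Omega : measurableType d)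
    (R : realType) (P : probability Omega R)
    (T1 T2 : nat -> Omega -> attach_tree)
    (hT1 : uniform_attachment_tree P T1)
    (hT2 : uniform_attachment_tree P T2)
    (hind : forall n : nat, (0 < n)%N -> independent_trees P (T1 n) (T2 n)) :
  (forall eps : R, 0 < eps ->
    (fun n : nat =>
       P [set w | n%:R `^ (2 * (Num.sqrt 2 - 1) - eps)
                  <= (uh_common_size (T1 n w) (T2 n w))%:R :> R])
      @ \oo --> 1%E) /\
  (fun n : nat =>
     P [set w | n%:R `^ (828%:R / 1000%:R)
                <= (uh_common_size (T1 n w) (T2 n w))%:R :> R])
    @ \oo --> 1%E.
Proof.
split=> [eps|]; first exact: cvg_prob_common.
have eps0 : 0 < 2 * (Num.sqrt 2 - 1) - 828%:R / 1000%:R :> R.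
  have r2 : Num.sqrt 2 * Num.sqrt 2 = 2 :> R by rewrite -expr2 sqr_sqrtr.
  have r0 : 0 <= Num.sqrt 2 :> R by exact: sqrtr_ge0.
  by move: (Num.sqrt 2) r0 r2 => r r0 r2; nra.
have := cvg_prob_common hT1 hT2 hind eps0.
by rewrite subKr.
Qed.
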